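(* Let $k$ be a positive integer. Any partition $\lambda$ with $m_\lambda(1)>0$ can be recovered from $\nu=\mathrm{prh}_k(\lambda)$; that is, if $\lambda$ and $\mu$ are partitions with $m_\lambda(1)>0$, $m_\mu(1)>0$ and $\mathrm{prh}_k(\lambda)=\mathrm{prh}_k(\mu)$, then $\lambda=\mu$.
   Context: A partition $\lambda=(\lambda_1,\dots,\lambda_\ell)$ is a nonincreasing finite sequence of positive integers; no condition is imposed on its sum. $m_\lambda(a)$ denotes the number of times the integer $a$ appears as a part of $\lambda$. For a positive integer $k$, $\mathrm{prh}_k(\lambda)$ is the partition whose parts (with multiplicity) are the summands of the complete homogeneous symmetric polynomial $h_k(\lambda_1,\dots,\lambda_\ell)=\sum_{1\le i_1\le\cdots\le i_k\le \ell}\lambda_{i_1}\cdots\lambda_{i_k}$, i.e. the multiset of all products $\lambda_{i_1}\cdots\lambda_{i_k}$ over $1\le i_1\le\cdots\le i_k\le \ell$, sorted in nonincreasing order. *)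

(* Defs.v *)
From mathcomp Require Import all_boot.

Set Implicit Arguments.
Unset Strict Implicit.
Unset Printing Implicit Defensive.

Definition is_partition (la : seq nat) : bool :=
  sorted geq la && (0 \notin la).

Definition mult (la : seq nat) (a : nat) : nat := count_mem a la.

(* The summands of h_k(la_1, ..., la_l), with multiplicity: one product for each
   weakly increasing k-tuple of (zero-based) indices i_1 <= ... <= i_k < l. *)
Definition h_summands (k : nat) (la : seq nat) : seq nat :=
  [seq \prod_(j < k) nth 0 la (tnth i j)
     | i : k.-tuple 'I_(size la) in
         [pred i : k.-tuple 'I_(size la) | sorted leq (map val i)]].

Definition prh (k : nat) (la : seq nat) : seq nat :=
  sort geq (h_summands k la).

Lemma prh_is_partition (k : nat) (la : seq nat) :
  is_partition la -> is_partition (prh k la).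
Proof.
case/andP=> _ la0; apply/andP; split.
  by apply: sort_sorted => m n; apply: leq_total.
rewrite mem_sort; apply/mapP=> -[i _] /esym/eqP; apply/negP.
rewrite -lt0n prodn_gt0 // => j.
rewrite lt0n; apply: contraNneq la0 => <-.
exact: mem_nth.
Qed.

(* Main.v *)
Require Import Defs.
From mathcomp Require Import all_boot.

Set Implicit Arguments.
Unset Strict Implicit.
Unset Printing Implicit Defensive.

(** Two distinct partitions [la] and [mu] that contain a part equal to 1 are
    compared from their small parts up.  Let [s] be their longest common suffix,
    and let [x] be the smaller of the two parts that come just before [s] (or the
    only one, if one of the partitions is exhausted).  Up to symmetry
    [la = p ++ x :: s] and [mu = q ++ s], where every part of [q] exceeds [x].
    Then the value [x] occurs strictly more often among the summands of [h_k] of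
    [la] than among those of [mu]:
    - parts greater than [x] cannot contribute to a product equal to [x], all
      parts being positive, so [q] is irrelevant on the side of [mu]
      ([count_hprods_large]);
    - on the side of [la], besides the products that use only [s], there is
      at least the product [x * 1 * ... * 1], the factor 1 being available in
      [x :: s] because the part 1 comes last ([count_hprods_lt]).

    All of this relies on the recursion
    [h_(k+1)(x, l) = x h_k(x, l) + h_(k+1)(l)], read as an identity between
    multisets of summands; [perm_h_summands] and [hprods_cons] provide it. *)

(** * Weakly increasing index sequences *)

(** Splitting on whether the first letter is 0 yields the two terms of the
    recursion [hprods_cons]: a leading 0 selects the head of the list, and shifted
    words select entries of its tail. *)
Fixpoint incr_words (k : nat) : nat -> seq (seq nat) :=
  if k is k'.+1 then
    fix words_k n :=
      if n is n'.+1 then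
        map (cons 0) (incr_words k' n'.+1) ++ map (map succn) (words_k n')
      else [::]
  else fun=> [:: [::]].

Lemma incr_wordsSS k n :
  incr_words k.+1 n.+1 =
    map (cons 0) (incr_words k n.+1) ++ map (map succn) (incr_words k.+1 n).
Proof. by []. Qed.

Lemma map_succn_pred s : 0 \notin s -> map succn (map predn s) = s.
Proof.
move=> s0; rewrite -map_comp -[RHS]map_id; apply/eq_in_map => x xs /=.
by rewrite prednK // lt0n; apply: contraNneq s0 => <-.
Qed.

Lemma mem_incr_words k n s :
  (s \in incr_words k n) =
    [&& size s == k, sorted leq s & all (fun i => i < n) s].
Proof.
elim: k n s => [|k IHk] n s; first by case: s => [|a s]; rewrite inE.
elim: n s => [|n IHn] s; first by case: s => [|a s]; rewrite //= !andbF.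
rewrite incr_wordsSS mem_cat; apply/orP/and3P.
- case=> /mapP[t]; rewrite ?IHk ?IHn => /and3P[/eqP tk t_sorted t_lt] ->.
    by split; rewrite /= ?tk ?t_lt //; case: t t_sorted {tk t_lt}.
  split; first by rewrite size_map tk.
    by rewrite sorted_map; apply: sub_sorted t_sorted.
  by rewrite all_map.
- case: s => [[]//|[|a] s] [sk s_sorted s_lt]; [left|right].
    apply/mapP; exists s => //; rewrite IHk; apply/and3P; split=> //.
    exact: path_sorted s_sorted.
  have s0 : 0 \notin a.+1 :: s.
    by rewrite inE; apply/negP => /(allP (order_path_min leq_trans s_sorted)).
  move: (a.+1 :: s) s0 sk s_sorted s_lt => {a} {}s s0 sk.
  rewrite -{1 2 3}(map_succn_pred s0) sorted_map all_map => s_sorted s_lt.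
  apply/mapP; exists (map predn s) => //.
  by rewrite IHn size_map; apply/and3P.
Qed.

Lemma incr_words_uniq k n : uniq (incr_words k n).
Proof.
elim: k n => [//|k IHk]; elim=> [//|n IHn].
rewrite incr_wordsSS cat_uniq !map_inj_uniq ?IHk ?IHn //=; last first.
- by move=> s t [].
- exact: inj_map succn_inj.
rewrite andbT; apply/hasPn => _ /mapP[s _ ->].
by apply/mapP => -[t _]; case: s.
Qed.

(** * The summands of the complete homogeneous polynomial, recursively *)

Definition hprods (k : nat) (l : seq nat) : seq nat :=
  [seq \prod_(i <- w) nth 0 l i | w <- incr_words k (size l)].

(** Tuples of ordinals and words of bounded integers are two encodings of the
    same index sequences; both enumerations are free of repetitions. *)
Lemma perm_h_summands k l : perm_eq (h_summands k l) (hprods k l).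
Proof.
rewrite /h_summands /hprods /image_mem.
set A := enum _.
have -> : [seq \prod_(j < k) nth 0 l (tnth i j) | i : k.-tuple 'I_(size l) <- A] =
  [seq \prod_(i <- w) nth 0 l i
     | w <- [seq map val (val i) | i : k.-tuple 'I_(size l) <- A]].
  by rewrite -map_comp; apply: eq_map => i /=; rewrite big_map big_tuple.
apply: perm_map; apply: uniq_perm; last 1 first.
- move=> w; rewrite mem_incr_words; apply/mapP/and3P.
  + case=> i; rewrite mem_enum inE => i_sorted ->; split=> //.
      by rewrite size_map size_tuple.
    by rewrite all_map; apply/allP => j _ /=.
  + case=> /eqP wk w_sorted w_lt.
    have w_val : map val (pmap (insub : nat -> option 'I_(size l)) w) = w.
      rewrite pmap_filter; last by move=> x; rewrite insubK.
      apply/all_filterP; apply: sub_all w_lt => x x_lt.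
      by rewrite insubT.
    have ik : size (pmap (insub : nat -> option 'I_(size l)) w) == k.
      by rewrite -wk -{2}w_val size_map.
    exists (Tuple ik); last by rewrite w_val.
    by rewrite mem_enum inE /= w_val.
- rewrite map_inj_uniq ?enum_uniq // => i j /(inj_map val_inj) ij.
  exact: val_inj.
- exact: incr_words_uniq.
Qed.

Lemma hprods0 l : hprods 0 l = [:: 1].
Proof. by rewrite /hprods /= big_nil. Qed.

Lemma hprods_cons k x l :
  hprods k.+1 (x :: l) = map (muln x) (hprods k (x :: l)) ++ hprods k.+1 l.
Proof.
rewrite /hprods incr_wordsSS map_cat -!map_comp; congr (_ ++ _).
  by apply: eq_map => w /=; rewrite big_cons.
by apply: eq_map => w /=; rewrite big_map.
Qed.

Lemma notin0_hprods k l : 0 \notin l -> 0 \notin hprods k l.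
Proof.
move=> l0; apply/mapP => -[w]; rewrite mem_incr_words => /and3P[_ _ /allP w_lt].
apply/eqP; rewrite eq_sym -lt0n big_seq prodn_cond_gt0 // => i /w_lt i_lt.
by rewrite lt0n; apply: contraNneq l0 => <-; apply: mem_nth.
Qed.

Lemma mem1_hprods k l : 1 \in l -> 1 \in hprods k l.
Proof.
elim: k l => [|k IHk] l l1; first by rewrite hprods0 inE.
elim: l l1 => [//|x l IHl] l1; rewrite hprods_cons mem_cat.
move: (l1); rewrite inE => /orP[/eqP x1|/IHl ->]; last by rewrite orbT.
by apply/orP; left; apply/mapP; exists 1; rewrite ?IHk // -x1.
Qed.

(** * Comparing the number of occurrences of a value *)

Lemma count_hprods_suffix a k p s :
  count_mem a (hprods k s) <= count_mem a (hprods k (p ++ s)).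
Proof.
case: k => [|k]; first by rewrite !hprods0.
elim: p => [//|y p IHp].
by rewrite cat_cons hprods_cons count_cat (leq_trans IHp) // leq_addl.
Qed.

(** A product of positive integers that involves a factor greater than [a]
    differs from [a]. *)
Lemma count_hprods_large a k q s :
    0 \notin q ++ s -> all (fun y => a < y) q ->
  count_mem a (hprods k (q ++ s)) = count_mem a (hprods k s).
Proof.
case: k => [|k]; first by rewrite !hprods0.
elim: q => [//|y q IHq] qs0 /andP[ay aq].
have qs0' : 0 \notin q ++ s by move: qs0; rewrite cat_cons inE negb_or => /andP[].
rewrite cat_cons hprods_cons count_cat IHq //.
suff -> : count_mem a (map (muln y) (hprods k (y :: q ++ s))) = 0 by [].
apply/count_memPn/mapP => -[t t_in a_eq].
have t_gt0 : 0 < t.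
  by rewrite lt0n; apply: contraTneq t_in => ->; apply: notin0_hprods.
by move: ay; rewrite a_eq ltnNge leq_pmulr.
Qed.

Lemma count_hprods_lt x k p q s :
    0 < k -> 0 \notin q ++ s -> all (fun y => x < y) q -> 1 \in x :: s ->
  count_mem x (hprods k (q ++ s)) < count_mem x (hprods k (p ++ x :: s)).
Proof.
case: k => [//|k] _ qs0 xq xs1; rewrite count_hprods_large //.
apply: leq_trans (count_hprods_suffix x k.+1 p (x :: s)).
rewrite hprods_cons count_cat -add1n leq_add2r -has_count has_pred1.
(* the product of x with k factors equal to 1 *)
by apply/mapP; exists 1; rewrite ?muln1 ?mem1_hprods.
Qed.

(** * Recovering a partition *)

Lemma geq_trans : transitive geq.
Proof. by move=> a b c /= ba /leq_trans->. Qed.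

Lemma partition_mem1_suffix p x s :
  is_partition (p ++ x :: s) -> 1 \in p ++ x :: s -> 1 \in x :: s.
Proof.
case/andP; rewrite (sorted_pairwise geq_trans).
rewrite pairwise_cat => /and3P[/allrelP p_ge _ _] ps0.
rewrite mem_cat => /orP[p1|//].
have := p_ge 1 x p1 (mem_head _ _); rewrite /= leq_eqVlt ltnS leqn0.
case/orP=> [/eqP->|/eqP x0]; first exact: mem_head.
by case/negP: ps0; rewrite x0 mem_cat mem_head orbT.
Qed.

Lemma partition_prefix_ge p y s :
  is_partition (rcons p y ++ s) -> all (fun z => y <= z) (rcons p y).
Proof.
case/andP; rewrite (sorted_pairwise geq_trans).
rewrite pairwise_cat pairwise_rcons => /and3P[_ /andP[p_ge _] _] _.
by rewrite all_rcons leqnn; apply: sub_all p_ge.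
Qed.

(** The induction removes the last parts of [la] and [mu] as long as they
    agree, moving them to the common suffix [s]. *)
Lemma hprods_inj_suffix k la mu s :
    0 < k -> is_partition (la ++ s) -> is_partition (mu ++ s) ->
    1 \in la ++ s -> 1 \in mu ++ s ->
    perm_eq (hprods k (la ++ s)) (hprods k (mu ++ s)) ->
  la = mu.
Proof.
move=> k_gt0.
(* A part x just before the common suffix t, opposed only to larger parts,
   makes the value x more frequent on its own side. *)
have extra_part x p q t : is_partition (rcons p x ++ t) -> is_partition (q ++ t) ->
    1 \in rcons p x ++ t -> all (fun y => x < y) q ->
    perm_eq (hprods k (rcons p x ++ t)) (hprods k (q ++ t)) -> False.
  rewrite cat_rcons => p_part /andP[_ qt0] p1 xq /permP/(_ (pred1 x)) eq_x.
  have := @count_hprods_lt x k p q t k_gt0 qt0 xq (partition_mem1_suffix p_part p1).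
  by rewrite eq_x ltnn.
elim/last_ind: la mu s => [|la x IHla] mu s; case/lastP: mu => [//|mu y].
- move=> la_part mu_part la1 mu1; rewrite perm_sym => eq_h.
  by case: (extra_part y mu [::] s).
- move=> la_part mu_part la1 mu1 eq_h.
  by case: (extra_part x la [::] s).
move=> la_part mu_part la1 mu1 eq_h.
case: (ltngtP x y) => [xy|yx|xy].
- case: (extra_part x la (rcons mu y) s) => //.
  by apply: sub_all (partition_prefix_ge mu_part) => z; apply: leq_trans.
- case: (extra_part y mu (rcons la x) s) => //; last by rewrite perm_sym.
  by apply: sub_all (partition_prefix_ge la_part) => z; apply: leq_trans.
rewrite -{y}xy !cat_rcons in la_part mu_part la1 mu1 eq_h *.
by rewrite (IHla mu (x :: s)).
Qed.

Theorem lemma4p3 (k : nat) (hk : 0 < k) (la mu : seq nat)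
    (hla : is_partition la) (hmu : is_partition mu)
    (hla1 : 0 < mult la 1) (hmu1 : 0 < mult mu 1)
    (hprh : prh k la = prh k mu) :
  la = mu.
Proof.
have mem1 l : 0 < mult l 1 -> 1 \in l by rewrite -has_count has_pred1.
apply: (@hprods_inj_suffix k la mu [::]); rewrite ?cats0 ?mem1 //.
rewrite -(permPl (perm_h_summands k la)) -(permPr (perm_h_summands k mu)).
by rewrite -(perm_sort geq) -[sort _ _]/(prh k la) hprh perm_sort.
Qed.
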